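(* Let $\boldsymbol{u}=(u_n)_{n\ge 0}$ be the Thue-Morse sequence over $\{-1,1\}$ with $u_0=-1$. There exists a continuous function $f_\infty:\mathbb{R}\to[-1,1]$ such that for every real $X$ $$\int_0^X f_\infty(x)\,dx+f_\infty(0)=f_\infty\left(\frac X2\right),$$ and such that: - for each integer $n\ge 0$, $f_\infty(2n+1)=u_n$ and $f_\infty(2n)=0$; - for each negative real number $x$, $f_\infty(x)=0$; - for each positive real number $x$, $|f_\infty(x)|=|f_\infty(x+2)|$.
   Context: The Thue-Morse sequence $\boldsymbol{u}=(u_n)_{n\geq 0}=(-1),1,1,(-1),1,(-1),(-1),1,\dots$ is the fixed point starting with $-1$ of the substitution $\tau(-1)=(-1)\,1$, $\tau(1)=1\,(-1)$ on the free monoid generated by $-1$ and $1$. Equivalently, $u_0=-1$ and $u_{2k}=u_k$, $u_{2k+1}=-u_k$ for all integers $k\ge 0$. *)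

(* Defs.v *)
From Stdlib Require Import Reals List Arith NArith Lia.
From Coquelicot Require Import Coquelicot.
Import ListNotations.
Open Scope R_scope.

(* The two letters stand for the numbers -1 and 1; see [letter_value]. *)
Inductive letter : Set := minus_one | plus_one.

Definition letter_value (a : letter) : R :=
  match a with minus_one => -1 | plus_one => 1 end.

Definition tau (a : letter) : list letter :=
  match a with
  | minus_one => [minus_one; plus_one]
  | plus_one => [plus_one; minus_one]
  end.

(* The morphism of the free monoid on the letters that extends [tau]. *)
Definition tau_word (w : list letter) : list letter := flat_map tau w.

Definition prefix (u : nat -> letter) (n : nat) : list letter :=
  map u (seq 0 n).

(* [tau] doubles lengths, so the image of an infinite word [u] is the infinite
   word having [tau_word (prefix u n)] as its prefix of length [2 * n] for
   every [n]. *)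
Definition tau_fixed_point (u : nat -> letter) : Prop :=
  forall n : nat, tau_word (prefix u n) = prefix u (2 * n).

Definition is_thue_morse (u : nat -> letter) : Prop :=
  tau_fixed_point u /\ u 0%nat = minus_one.

Definition opp_letter (a : letter) : letter :=
  match a with minus_one => plus_one | plus_one => minus_one end.

Lemma tau_opp_letter (a : letter) : tau a = [a; opp_letter a].
Proof. now destruct a. Qed.

Lemma prefix_S (u : nat -> letter) (n : nat) :
  prefix u (S n) = prefix u n ++ [u n].
Proof. unfold prefix. now rewrite seq_S, map_app. Qed.

Lemma is_thue_morse_rec (u : nat -> letter) :
  is_thue_morse u <->
  u 0%nat = minus_one /\
  forall k : nat,
    u (2 * k)%nat = u k /\ u (2 * k + 1)%nat = opp_letter (u k).
Proof.
  assert (E : forall n, tau_word (prefix u (S n)) =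
                        tau_word (prefix u n) ++ [u n; opp_letter (u n)]).
  { intros n. unfold tau_word. rewrite prefix_S, flat_map_app. simpl.
    now rewrite app_nil_r, tau_opp_letter. }
  assert (D : forall n, prefix u (2 * S n) =
                        prefix u (2 * n) ++ [u (2 * n); u (2 * n + 1)]%nat).
  { intros n. replace (2 * S n)%nat with (S (S (2 * n))) by lia.
    rewrite !prefix_S, <- app_assoc.
    now replace (2 * n + 1)%nat with (S (2 * n)) by lia. }
  split.
  - intros [F H0]. split; [exact H0|]. intros k.
    pose proof (F (S k)) as H. rewrite E, D, (F k) in H.
    apply app_inv_head in H. now injection H as H1 H2.
  - intros [H0 H]. split; [|exact H0]. intros n.
    induction n as [|n IH]; [reflexivity|].
    destruct (H n) as [H1 H2]. now rewrite E, D, IH, H1, H2.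
Qed.

Lemma is_thue_morse_unique (u v : nat -> letter) :
  is_thue_morse u -> is_thue_morse v -> forall n : nat, u n = v n.
Proof.
  rewrite !is_thue_morse_rec. intros [u0 Hu] [v0 Hv] n.
  induction n as [n IH] using (well_founded_induction lt_wf).
  destruct (Nat.eq_dec n 0) as [->|Hn]; [congruence|].
  destruct (Nat.Even_or_Odd n) as [[k Hk]|[k Hk]]; subst n;
    destruct (Hu k) as [U1 U2], (Hv k) as [V1 V2];
    rewrite ?U1, ?V1, ?U2, ?V2, (IH k); auto; lia.
Qed.

Fixpoint odd_ones (p : positive) : bool :=
  match p with
  | xH => true
  | xO q => odd_ones q
  | xI q => negb (odd_ones q)
  end.

Lemma is_thue_morse_exists : exists u : nat -> letter, is_thue_morse u.
Proof.
  exists (fun n => match N.of_nat n with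
                   | N0 => minus_one
                   | Npos p => if odd_ones p then plus_one else minus_one
                   end).
  apply is_thue_morse_rec. split; [reflexivity|]. intros k.
  replace (N.of_nat (2 * k)) with (N.double (N.of_nat k)) by lia.
  replace (N.of_nat (2 * k + 1)) with (N.succ_double (N.of_nat k)) by lia.
  destruct (N.of_nat k) as [|p]; simpl; [now split|].
  now destruct (odd_ones p).
Qed.

(* Main.v *)
Require Import Defs.
From Stdlib Require Import Reals ZArith Lra Lia.
From Coquelicot Require Import Coquelicot.
Open Scope R_scope.

(* Let [F] be the distribution function of the sum of the [U_j / 2^j], [j >= 1], with
   [U_j] independent and uniform on [0,1] (the Fabius function).  It is the
   fixed point of [smear], the action on distribution functions of
   [X |-> (X + U) / 2].  Since [smear] halves horizontal displacements, its
   iterates converge.  The fixed point satisfies [F' x = 2 F (2x) - 2 F (2x-1)],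
   so the bump [phi x = F x - F (x-1)], supported in [0,2], satisfies
   [phi' x = 2 phi (2x) - 2 phi (2x-2)].  Because [u_(2n) = u_n] and
   [u_(2n+1) = - u_n], the sum [f x] of the [u_n phi (x - 2n)] satisfies
   [f' x = 2 f (2x)], which integrates to the functional equation. *)

(** * Distribution functions on [[0,1]] and the smearing operator *)

(** Given [U = u], the event [(X + U) / 2 <= x] reads [X <= 2 * x - u]; the integration variable is
    [s = 1 - u]. *)
Definition smear (F : R -> R) (x : R) : R :=
  RInt (fun s => F (2 * x - 1 + s)) 0 1.

(** The constant 2 in [cdf_lip] is the one that [smear] reproduces: the derivative
    [2 * F (2 * x) - 2 * F (2 * x - 1)] of [smear F] lies between 0 and 2. *)
Record unit_cdf (F : R -> R) : Prop := {
  cdf_incr : forall x y, x <= y -> F x <= F y;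
  cdf_lip : forall x y, x <= y -> F y - F x <= 2 * (y - x);
  cdf_0 : forall x, x <= 0 -> F x = 0;
  cdf_1 : forall x, 1 <= x -> F x = 1 }.

Lemma cdf_bounds F : unit_cdf F -> forall x, 0 <= F x <= 1.
Proof.
  intros HF x. split.
  - rewrite <- (cdf_0 F HF (Rmin x 0) (Rmin_r _ _)).
    apply (cdf_incr F HF), Rmin_l.
  - rewrite <- (cdf_1 F HF (Rmax x 1) (Rmax_r _ _)).
    apply (cdf_incr F HF), Rmax_l.
Qed.

Lemma cdf_continuous F : unit_cdf F -> forall x, continuous F x.
Proof.
  intros HF x. apply continuity_pt_filterlim. intros eps He.
  exists (eps / 4). split; [lra|]. intros y [_ Hy].
  unfold dist in *; simpl in *; unfold R_dist in *.
  apply Rabs_def2 in Hy. apply Rabs_def1;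
    destruct (Rle_dec x y) as [H|H];
    try (pose proof (cdf_incr F HF x y H); pose proof (cdf_lip F HF x y H); lra);
    assert (H' : y <= x) by lra;
    pose proof (cdf_incr F HF y x H'); pose proof (cdf_lip F HF y x H'); lra.
Qed.

Lemma ex_RInt_cdf F a b : unit_cdf F -> ex_RInt F a b.
Proof.
  intros HF. apply (ex_RInt_continuous (V := R_CompleteNormedModule)).
  intros z _. now apply cdf_continuous.
Qed.

Lemma ex_RInt_cdf_shift F c a b :
  unit_cdf F -> ex_RInt (fun s => F (c + s)) a b.
Proof.
  intros HF. apply (ex_RInt_continuous (V := R_CompleteNormedModule)).
  intros z _. apply (continuous_comp (fun s => c + s) F).
  - apply (continuous_plus (V := R_NormedModule));
      [apply continuous_const | apply continuous_id].
  - now apply cdf_continuous.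
Qed.

(** A substitution moves [x] out of the integrand into the limits, where the fundamental theorem of
    calculus can differentiate. *)
Lemma smear_primitive F x : unit_cdf F ->
  smear F x = RInt F 0 (2 * x) - RInt F 0 (2 * x - 1).
Proof.
  intros HF. unfold smear.
  pose proof (RInt_comp_lin F 1 (2 * x - 1) 0 1 (ex_RInt_cdf F _ _ HF)) as E.
  replace (1 * 0 + (2 * x - 1)) with (2 * x - 1) in E by ring.
  replace (1 * 1 + (2 * x - 1)) with (2 * x) in E by ring.
  rewrite (RInt_ext _ (fun s => F (2 * x - 1 + s))) in E.
  2:{ intros s _. change (1 * F (1 * s + (2 * x - 1)) = F (2 * x - 1 + s)).
      rewrite Rmult_1_l. f_equal. ring. }
  rewrite E.
  apply (Rplus_eq_reg_l (RInt F 0 (2 * x - 1))). rewrite Rplus_minus.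
  apply (RInt_Chasles F); now apply ex_RInt_cdf.
Qed.

Lemma is_derive_smear F x : unit_cdf F ->
  is_derive (smear F) x (2 * F (2 * x) - 2 * F (2 * x - 1)).
Proof.
  intros HF.
  apply (is_derive_ext (fun x => RInt F 0 (2 * x) - RInt F 0 (2 * x - 1))).
  { intros t. symmetry. now apply smear_primitive. }
  assert (P : forall b, is_derive (RInt F 0) b (F b)).
  { intros b. apply (is_derive_RInt F (RInt F 0) 0 b).
    - apply filter_forall. intros c. apply (RInt_correct F), ex_RInt_cdf, HF.
    - now apply cdf_continuous. }
  apply (is_derive_minus (V := R_NormedModule));
    apply (is_derive_comp (V := R_NormedModule) (RInt F 0)); auto;
    auto_derive; trivial; ring.
Qed.

Lemma smear_cdf F : unit_cdf F -> unit_cdf (smear F).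
Proof.
  intros HF.
  assert (MVT : forall x y, x <= y ->
    exists c, smear F y - smear F x = (2 * F (2 * c) - 2 * F (2 * c - 1)) * (y - x)).
  { intros x y _.
    destruct (MVT_gen (smear F) x y (fun c => 2 * F (2 * c) - 2 * F (2 * c - 1)))
      as [c [_ Hc]].
    - intros c _. now apply is_derive_smear.
    - intros c _. apply continuity_pt_filterlim.
      apply (ex_derive_continuous (smear F)).
      eexists. now apply is_derive_smear.
    - now exists c. }
  split.
  - intros x y H. destruct (MVT x y H) as [c Hc].
    pose proof (cdf_incr F HF (2 * c - 1) (2 * c)). nra.
  - intros x y H. destruct (MVT x y H) as [c Hc].
    pose proof (cdf_bounds F HF (2 * c)). pose proof (cdf_bounds F HF (2 * c - 1)).
    nra.
  - intros x H. unfold smear.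
    rewrite (RInt_ext _ (fun _ => 0)), RInt_const.
    + apply Rmult_0_r.
    + rewrite Rmin_left, Rmax_right by lra. intros s Hs. apply (cdf_0 F HF). lra.
  - intros x H. unfold smear.
    rewrite (RInt_ext _ (fun _ => 1)), RInt_const.
    + unfold scal; simpl; unfold mult; simpl. lra.
    + rewrite Rmin_left, Rmax_right by lra. intros s Hs. apply (cdf_1 F HF). lra.
Qed.

(** * Horizontal distance and its contraction *)

(* Distance at most [a] in the horizontal direction: in terms of random
   variables, a coupling with [|X - Y| <= a]. *)
Definition shift_close (a : R) (F G : R -> R) : Prop :=
  forall x, F (x - a) <= G x <= F (x + a).

(** The integrand sees [2 * x], so moving [x] by [a / 2] moves its argument by [a]. *)
Lemma smear_shift_close a F G : unit_cdf F -> unit_cdf G ->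
  shift_close a F G -> shift_close (a / 2) (smear F) (smear G).
Proof.
  intros HF HG H x. unfold smear.
  split; apply RInt_le; try lra; try (now apply ex_RInt_cdf_shift);
    intros s _.
  - replace (2 * (x - a / 2) - 1 + s) with (2 * x - 1 + s - a) by field. apply H.
  - replace (2 * (x + a / 2) - 1 + s) with (2 * x - 1 + s + a) by field. apply H.
Qed.

(** Both distributions live on an interval of length 1. *)
Lemma cdf_shift_close F G : unit_cdf F -> unit_cdf G -> shift_close 1 F G.
Proof.
  intros HF HG x. split.
  - destruct (Rle_dec x 1).
    + rewrite (cdf_0 F HF) by lra. now apply cdf_bounds.
    + rewrite (cdf_1 G HG) by lra. now apply cdf_bounds.
  - destruct (Rle_dec x 0).
    + rewrite (cdf_0 G HG) by lra. now apply cdf_bounds.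
    + rewrite (cdf_1 F HF) by lra. now apply cdf_bounds.
Qed.

(** The Lipschitz bound on [F] turns a horizontal distance into a vertical one. *)
Lemma shift_close_dist a F G x : unit_cdf F -> 0 <= a ->
  shift_close a F G -> Rabs (G x - F x) <= 2 * a.
Proof.
  intros HF Ha H. destruct (H x) as [H1 H2].
  pose proof (cdf_lip F HF (x - a) x). pose proof (cdf_lip F HF x (x + a)).
  apply Rabs_le. lra.
Qed.

Lemma half_pow_pos k : 0 < (1 / 2) ^ k.
Proof. apply pow_lt. lra. Qed.

Lemma half_pow_small eps : 0 < eps ->
  exists N, forall k, (N <= k)%nat -> (1 / 2) ^ k < eps.
Proof.
  intros He. destruct (pow_lt_1_zero (1 / 2)) with (y := eps) as [N HN]; trivial.
  - rewrite Rabs_right; lra.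
  - exists N. intros k Hk. specialize (HN k Hk).
    now rewrite Rabs_right in HN by (apply Rle_ge, Rlt_le, half_pow_pos).
Qed.

(** * The Fabius function as the limit of the iterates *)

Fixpoint smear_iter (k : nat) : R -> R :=
  match k with
  | O => fun x => Rmax 0 (Rmin x 1)
  | S k => smear (smear_iter k)
  end.

Lemma smear_iter_cdf k : unit_cdf (smear_iter k).
Proof.
  induction k as [|k IH]; [|now apply smear_cdf].
  split; simpl; intros; unfold Rmax, Rmin;
    repeat destruct (Rle_dec _ _); lra.
Qed.

(** The iterates of index 0 and [m] are at distance at most 1, and each of the [k] further smearings
    applied to both halves this. *)
Lemma smear_iter_close k m :
  shift_close ((1 / 2) ^ k) (smear_iter k) (smear_iter (k + m)).
Proof.
  induction k as [|k IH].
  - apply cdf_shift_close; apply smear_iter_cdf.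
  - replace ((1 / 2) ^ S k) with ((1 / 2) ^ k / 2) by (simpl; field).
    now apply smear_shift_close; try apply smear_iter_cdf.
Qed.

Lemma smear_iter_converges x : ex_finite_lim_seq (fun k => smear_iter k x).
Proof.
  apply ex_lim_seq_cauchy_corr. intros eps.
  (* [shift_close_dist] costs a factor 2, and the triangle inequality through the [N]-th iterate
     another. *)
  destruct (half_pow_small (eps / 4)) as [N HN].
  { pose proof (cond_pos eps). lra. }
  assert (C : forall n, (N <= n)%nat ->
            Rabs (smear_iter n x - smear_iter N x) < eps / 2).
  { intros n Hn. replace n with (N + (n - N))%nat by lia.
    eapply Rle_lt_trans.
    - apply shift_close_dist with (a := (1 / 2) ^ N).
      + apply smear_iter_cdf.
      + apply Rlt_le, half_pow_pos.
      + apply smear_iter_close.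
    - specialize (HN N (le_n N)). lra. }
  exists N. intros n m Hn Hm.
  pose proof (C n Hn) as Cn. pose proof (C m Hm) as Cm.
  apply Rabs_def2 in Cn, Cm. apply Rabs_def1; lra.
Qed.

(** By [smear_iter_converges] the limit is finite, so [real] never returns its default value. *)
Definition fabius (x : R) : R := real (Lim_seq (fun k => smear_iter k x)).

Lemma is_lim_fabius x : is_lim_seq (fun k => smear_iter k x) (fabius x).
Proof. apply Lim_seq_correct', smear_iter_converges. Qed.

Lemma fabius_cdf : unit_cdf fabius.
Proof.
  split.
  - intros x y H.
    apply (is_lim_seq_le (fun k => smear_iter k x) (fun k => smear_iter k y)
      (fabius x) (fabius y)); try apply is_lim_fabius.
    intros k. now apply (cdf_incr _ (smear_iter_cdf k)).
  - intros x y H.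
    apply (is_lim_seq_le (fun k => smear_iter k y - smear_iter k x)
      (fun _ => 2 * (y - x)) (fabius y - fabius x) (2 * (y - x))).
    + intros k. now apply (cdf_lip _ (smear_iter_cdf k)).
    + apply is_lim_seq_minus'; apply is_lim_fabius.
    + apply is_lim_seq_const.
  - intros x H. unfold fabius. rewrite (Lim_seq_ext _ (fun _ => 0)).
    + now rewrite Lim_seq_const.
    + intros k. now apply (cdf_0 _ (smear_iter_cdf k)).
  - intros x H. unfold fabius. rewrite (Lim_seq_ext _ (fun _ => 1)).
    + now rewrite Lim_seq_const.
    + intros k. now apply (cdf_1 _ (smear_iter_cdf k)).
Qed.

Lemma smear_iter_fabius_close k :
  shift_close ((1 / 2) ^ k) (smear_iter k) fabius.
Proof.
  intros x.
  assert (L : is_lim_seq (fun m => smear_iter (k + m) x) (fabius x)).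
  { apply (is_lim_seq_ext (fun m => smear_iter (m + k) x)).
    - intros m. now rewrite Nat.add_comm.
    - apply (is_lim_seq_incr_n (fun m => smear_iter m x)), is_lim_fabius. }
  split.
  - apply (is_lim_seq_le (fun _ => smear_iter k (x - (1 / 2) ^ k))
      (fun m => smear_iter (k + m) x) (smear_iter k (x - (1 / 2) ^ k)) (fabius x));
      [ | apply is_lim_seq_const | exact L].
    intros m. apply smear_iter_close.
  - apply (is_lim_seq_le (fun m => smear_iter (k + m) x)
      (fun _ => smear_iter k (x + (1 / 2) ^ k)) (fabius x)
      (smear_iter k (x + (1 / 2) ^ k))); [ | exact L | apply is_lim_seq_const].
    intros m. apply smear_iter_close.
Qed.

(** Both sides are close to the iterate of index [S k], for every [k]. The contraction thus replaces
    an exchange of limit and integral. *)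
Lemma smear_fabius x : smear fabius x = fabius x.
Proof.
  assert (C : forall k, Rabs (smear fabius x - fabius x) <= 4 * (1 / 2) ^ k).
  { intros k.
    assert (A : Rabs (smear fabius x - smear_iter (S k) x) <= 2 * ((1 / 2) ^ k / 2)).
    { apply shift_close_dist.
      - apply smear_iter_cdf.
      - pose proof (half_pow_pos k). lra.
      - apply smear_shift_close; [apply smear_iter_cdf | apply fabius_cdf |].
        apply smear_iter_fabius_close. }
    assert (B : Rabs (fabius x - smear_iter (S k) x) <= 2 * (1 / 2) ^ S k).
    { apply shift_close_dist.
      - apply smear_iter_cdf.
      - apply Rlt_le, half_pow_pos.
      - apply smear_iter_fabius_close. }
    pose proof (half_pow_pos k). simpl pow in B.
    apply Rabs_le_between in A, B. apply Rabs_le. lra. }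
  destruct (Req_dec (smear fabius x - fabius x) 0) as [E|E]; [lra|].
  apply Rabs_pos_lt in E.
  destruct (half_pow_small (Rabs (smear fabius x - fabius x) / 4)) as [N HN]; [lra|].
  specialize (HN N (le_n N)). specialize (C N). lra.
Qed.

Lemma is_derive_fabius x :
  is_derive fabius x (2 * fabius (2 * x) - 2 * fabius (2 * x - 1)).
Proof.
  apply (is_derive_ext (smear fabius)).
  - apply smear_fabius.
  - apply is_derive_smear, fabius_cdf.
Qed.

(** * The bump and its differential equation *)

Definition bump (x : R) : R := fabius x - fabius (x - 1).

Lemma is_derive_bump x :
  is_derive bump x (2 * bump (2 * x) - 2 * bump (2 * x - 2)).
Proof.
  unfold bump.
  (* The two terms in [fabius (2 * x - 1)] and [fabius (2 * x - 2)] trade places; the factor 1 is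
     the inner derivative of [x - 1]. *)
  replace (2 * (fabius (2 * x) - fabius (2 * x - 1)) -
           2 * (fabius (2 * x - 2) - fabius (2 * x - 2 - 1)))
    with ((2 * fabius (2 * x) - 2 * fabius (2 * x - 1)) -
          1 * (2 * fabius (2 * (x - 1)) - 2 * fabius (2 * (x - 1) - 1))).
  - apply (is_derive_minus (V := R_NormedModule)).
    + apply is_derive_fabius.
    + apply (is_derive_comp (V := R_NormedModule) fabius).
      * apply is_derive_fabius.
      * auto_derive; trivial; ring.
  - replace (2 * (x - 1)) with (2 * x - 2) by ring. ring.
Qed.

Lemma bump_bounds x : 0 <= bump x <= 1.
Proof.
  unfold bump. pose proof (cdf_incr _ fabius_cdf (x - 1) x).
  pose proof (cdf_bounds _ fabius_cdf x).
  pose proof (cdf_bounds _ fabius_cdf (x - 1)). lra.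
Qed.

Lemma bump_left x : x <= 0 -> bump x = 0.
Proof. intros H. unfold bump. rewrite !(cdf_0 _ fabius_cdf) by lra. ring. Qed.

Lemma bump_right x : 2 <= x -> bump x = 0.
Proof. intros H. unfold bump. rewrite !(cdf_1 _ fabius_cdf) by lra. ring. Qed.

Lemma bump_1 : bump 1 = 1.
Proof.
  unfold bump.
  rewrite (cdf_1 _ fabius_cdf), (cdf_0 _ fabius_cdf) by lra. ring.
Qed.

(** * Signed sums of translated bumps *)

Definition bump_sum (s : nat -> R) (N : nat) (x : R) : R :=
  sum_f_R0 (fun n => s n * bump (x - 2 * INR n)) N.

(** Differentiating bump [n] yields bumps [2 * n] and [2 * n + 1] at [2 * x] with opposite signs,
    which are exactly the signs that [s] prescribes. Indices up to [N] thus produce those up to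
    [2 * N + 1]. *)
Lemma is_derive_bump_sum (s : nat -> R) N x :
  (forall k, s (2 * k)%nat = s k) -> (forall k, s (2 * k + 1)%nat = - s k) ->
  is_derive (bump_sum s N) x (2 * bump_sum s (2 * N + 1) (2 * x)).
Proof.
  intros Heven Hodd.
  assert (D : forall n, is_derive (fun x => s n * bump (x - 2 * INR n)) x
    (2 * (s (2 * n)%nat * bump (2 * x - 2 * INR (2 * n)) +
          s (2 * n + 1)%nat * bump (2 * x - 2 * INR (2 * n + 1))))).
  { intros n. rewrite Heven, Hodd, plus_INR, mult_INR.
    change (INR 2) with 2. change (INR 1) with 1.
    replace (2 * (s n * bump (2 * x - 2 * (2 * INR n)) +
                  - s n * bump (2 * x - 2 * (2 * INR n + 1))))
      with (s n * (1 * (2 * bump (2 * (x - 2 * INR n)) -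
                        2 * bump (2 * (x - 2 * INR n) - 2)))).
    - apply (is_derive_scal (fun x => bump (x - 2 * INR n))).
      apply (is_derive_comp (V := R_NormedModule) bump).
      + apply is_derive_bump.
      + auto_derive; trivial; ring.
    - replace (2 * x - 2 * (2 * INR n)) with (2 * (x - 2 * INR n)) by ring.
      replace (2 * x - 2 * (2 * INR n + 1)) with (2 * (x - 2 * INR n) - 2) by ring.
      ring. }
  unfold bump_sum. induction N as [|N IH].
  - exact (D 0%nat).
  - replace (2 * S N + 1)%nat with (S (S (2 * N + 1))) by lia.
    rewrite !(tech5 _ (S (2 * N + 1))), !(tech5 _ (2 * N + 1)).
    apply (is_derive_ext (fun x =>
      sum_f_R0 (fun n => s n * bump (x - 2 * INR n)) N +
      s (S N) * bump (x - 2 * INR (S N)))).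
    { intros t. now rewrite tech5. }
    rewrite Rplus_assoc, Rmult_plus_distr_l.
    apply (is_derive_plus (V := R_NormedModule)); [exact IH|].
    replace (S (2 * N + 1)) with (2 * S N)%nat by lia.
    replace (S (2 * S N)) with (2 * S N + 1)%nat by lia.
    apply D.
Qed.

(** Every added bump starts at [2 * (N + 1)] or later. *)
Lemma bump_sum_extend s N M x : x <= 2 * (INR N + 1) -> (N <= M)%nat ->
  bump_sum s M x = bump_sum s N x.
Proof.
  intros Hx HM. induction HM as [|M HM IH]; [reflexivity|].
  unfold bump_sum in *. rewrite tech5, IH, bump_left; [ring|].
  apply le_INR in HM. rewrite S_INR. lra.
Qed.

(** All earlier bumps have ended by [2 * n]. *)
Lemma bump_sum_cell s n x : 2 * INR n <= x ->
  bump_sum s n x = s n * bump (x - 2 * INR n).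
Proof.
  intros Hx. destruct n as [|n]; [reflexivity|].
  unfold bump_sum. rewrite tech5, sum_eq_R0; [ring|].
  intros k Hk. rewrite bump_right; [ring|].
  apply le_INR in Hk. rewrite S_INR in Hx. lra.
Qed.

(* Only the bumps with [2 * n < x] meet [x], so truncating the series at
   [n = Z.to_nat (up x)] loses nothing. *)
Definition bump_series (s : nat -> R) (x : R) : R :=
  bump_sum s (Z.to_nat (up x)) x.

Lemma bump_series_sum s N x : x <= 2 * (INR N + 1) ->
  bump_series s x = bump_sum s N x.
Proof.
  intros Hx. unfold bump_series. set (M := Z.to_nat (up x)).
  assert (HM : x <= 2 * (INR M + 1)).
  { unfold M. destruct (archimed x) as [H _].
    pose proof (pos_INR (Z.to_nat (up x))).
    (* [Z.to_nat] sends a negative [up x] to 0, but then [x] is negative too. *)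
    destruct (Z.le_gt_cases 0 (up x)) as [Z|Z].
    - rewrite INR_IZR_INZ in *. rewrite Z2Nat.id in * by exact Z. lra.
    - assert (IZR (up x) < 0) by (apply IZR_lt; lia). lra. }
  destruct (Nat.le_ge_cases N M).
  - now apply bump_sum_extend.
  - symmetry. now apply bump_sum_extend.
Qed.

Lemma bump_series_neg s x : x <= 0 -> bump_series s x = 0.
Proof.
  intros H. rewrite (bump_series_sum s 0) by (simpl; lra).
  unfold bump_sum; simpl. rewrite bump_left by lra. ring.
Qed.

Lemma bump_series_cell s n x : 2 * INR n <= x <= 2 * INR n + 2 ->
  bump_series s x = s n * bump (x - 2 * INR n).
Proof.
  intros H. rewrite (bump_series_sum s n) by lra. apply bump_sum_cell. lra.
Qed.

Lemma even_cell x : 0 <= x -> exists n : nat, 2 * INR n <= x <= 2 * INR n + 2.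
Proof.
  intros H. destruct (nfloor_ex (x / 2)) as [n Hn]; [lra|]. exists n. lra.
Qed.

(** With [N > x], the series agrees with one finite sum on a whole neighbourhood of [x]. *)
Lemma is_derive_bump_series (s : nat -> R) x :
  (forall k, s (2 * k)%nat = s k) -> (forall k, s (2 * k + 1)%nat = - s k) ->
  is_derive (bump_series s) x (2 * bump_series s (2 * x)).
Proof.
  intros Heven Hodd.
  destruct (INR_unbounded x) as [N HN].
  rewrite (bump_series_sum s (2 * N + 1) (2 * x)).
  2:{ pose proof (pos_INR N). rewrite plus_INR, mult_INR. simpl. lra. }
  apply (is_derive_ext_loc (bump_sum s N)).
  - assert (He : 0 < INR N - x) by lra. exists (mkposreal _ He). intros y Hy.
    symmetry. apply bump_series_sum.
    apply Rabs_def2 in Hy. simpl in Hy. unfold minus, plus, opp in Hy; simpl in Hy.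
    pose proof (pos_INR N). lra.
  - now apply is_derive_bump_sum.
Qed.

(** * The series with Thue-Morse signs and its properties *)

Theorem theorem1 (u : nat -> letter) (Hu : is_thue_morse u) :
  exists f : R -> R,
    (forall x : R, continuous f x) /\
    (forall x : R, -1 <= f x <= 1) /\
    (forall X : R, RInt f 0 X + f 0 = f (X / 2)) /\
    (forall n : nat,
        f (2 * INR n + 1) = letter_value (u n) /\ f (2 * INR n) = 0) /\
    (forall x : R, x < 0 -> f x = 0) /\
    (forall x : R, 0 < x -> Rabs (f x) = Rabs (f (x + 2))).
Proof.
  apply is_thue_morse_rec in Hu. destruct Hu as [_ Hu].
  set (s := fun n => letter_value (u n)).
  assert (Heven : forall k, s (2 * k)%nat = s k).
  { intros k. unfold s. now rewrite (proj1 (Hu k)). }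
  assert (Hodd : forall k, s (2 * k + 1)%nat = - s k).
  { intros k. unfold s. rewrite (proj2 (Hu k)). destruct (u k); simpl; ring. }
  assert (Habs : forall k, s k = -1 \/ s k = 1).
  { intros k. unfold s. destruct (u k); auto. }
  pose proof (fun x => is_derive_bump_series s x Heven Hodd) as D.
  assert (C : forall x, continuous (bump_series s) x).
  { intros x. apply (ex_derive_continuous (bump_series s)). eexists. apply D. }
  exists (bump_series s). split; [exact C|].
  split; [|split; [|split; [|split]]].
  - intros x. destruct (Rle_dec x 0) as [H|H]; [rewrite bump_series_neg; lra|].
    destruct (even_cell x) as [n Hn]; [lra|]. rewrite (bump_series_cell s n) by lra.
    pose proof (bump_bounds (x - 2 * INR n)). destruct (Habs n) as [-> | ->]; lra.
  - intros X.
    (* By [f' x = 2 f (2x)], the function [f (t / 2)] is a primitive of [f]; moreover [f 0 = 0]. *)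
    assert (H : is_RInt (bump_series s) 0 X
      (minus (bump_series s (X / 2)) (bump_series s (0 / 2)))).
    { apply (is_RInt_derive (V := R_CompleteNormedModule)
        (fun t => bump_series s (t / 2))); [|intros; apply C].
      intros t _.
      replace (bump_series s t) with (/ 2 * (2 * bump_series s (2 * (t / 2)))).
      - apply (is_derive_comp (V := R_NormedModule) (bump_series s)); [apply D|].
        auto_derive; trivial; field.
      - replace (2 * (t / 2)) with t by field. field. }
    apply (is_RInt_unique (V := R_CompleteNormedModule)) in H. rewrite H.
    rewrite !(bump_series_neg s 0), (bump_series_neg s (0 / 2)) by lra.
    unfold minus, plus, opp; simpl. ring.
  - intros n. rewrite !(bump_series_cell s n) by lra.
    replace (2 * INR n + 1 - 2 * INR n) with 1 by ring.
    rewrite bump_1, bump_left by lra. split; [apply Rmult_1_r | ring].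
  - intros x H. apply bump_series_neg. lra.
  (* A shift by 2 passes to the next cell, which carries the same bump up to sign. *)
  - intros x H. destruct (even_cell x) as [n Hn]; [lra|].
    rewrite (bump_series_cell s n x) by lra.
    rewrite (bump_series_cell s (S n) (x + 2)) by (rewrite S_INR; lra).
    rewrite S_INR. replace (x + 2 - 2 * (INR n + 1)) with (x - 2 * INR n) by ring.
    rewrite !Rabs_mult. f_equal.
    destruct (Habs n) as [-> | ->], (Habs (S n)) as [-> | ->];
      rewrite ?Rabs_m1, ?Rabs_R1; reflexivity.
Qed.
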